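(* (i) Let $G,H$ be finite nonabelian CA-groups with $b_G$, $b_H$ maximal abelian subgroups respectively, and put $m_G=b_G-1$, $m_H=b_H-1$. Then the commuting difference lattice of $G\times H$ has a diagonal presentation whose nontrivial entries are $m_G$ with multiplicity $b_H$, $m_H$ with multiplicity $b_G$, and $m_Gm_H$ once; hence the product of the nontrivial invariant factors of the commuting difference lattice of $G\times H$ is $m_G^{\,b_H+1}m_H^{\,b_G+1}$. (ii) If $A$ is a finite abelian group, then its commuting difference lattice is $0$, and for a finite group $G$ the group $G\times A$ has the same Smith spectrum as $G$.
   Context: A finite group $G$ is a CA-group if the centralizer of every non-central element is abelian. Commuting difference lattice: for a finite group $G$ let $P$ be the $G\times G$ zero-one matrix with $P_{g,h}=1$ if $gh=hg$ and $P_{g,h}=0$ otherwise. The commuting difference lattice of $G$ is the $\mathbb{Z}$-span in $\mathbb{Z}^{G}$ of all differences of rows $P_g-P_{g'}$, $g,g'\in G$. The invariant factors of a lattice $M\subseteq\mathbb{Z}^N$ of rank $r$ are the nonzero Smith normal form entries $d_1\mid\cdots\mid d_r$ of any integer matrix whose rows generate $M$; the nontrivial ones are those greater than $1$. The Smith spectrum of $G$ is the list of nontrivial invariant factors of its commuting difference lattice. A diagonal presentation of a lattice $M\subseteq\mathbb{Z}^N$ of rank $r$ with (positive integer) entries $a_1,\dots,a_r$ means that a generating matrix of $M$ can be brought by unimodular integer row and column operations to a diagonal matrix with nonzero diagonal entries $a_1,\dots,a_r$ (no divisibility chain required); equivalently there is a $\mathbb{Z}$-basis $f_1,\dots,f_N$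 of $\mathbb{Z}^N$ such that $a_1f_1,\dots,a_rf_r$ is a basis of $M$. Nontrivial entries are those greater than $1$. *)

(* Defs.v *)
From HB Require Import structures.
From mathcomp Require Import all_boot all_order all_algebra all_fingroup all_solvable.

Set Implicit Arguments.
Unset Strict Implicit.
Unset Printing Implicit Defensive.

Import Order.TTheory GRing.Theory Num.Theory.

Local Open Scope ring_scope.

Definition CA_group (gT : finGroupType) (G : {group gT}) : Prop :=
  {in (G :\: 'Z(G))%g, forall x, abelian 'C_G[x]%g}.

Definition max_abelian_subgroups (gT : finGroupType) (G : {group gT}) :
    {set {group gT}} :=
  [set A : {group gT} | [max A | (A \subset G) && abelian A]%g].

(* Z^G is 'rV[int]_#|G|, the element of G at index i being enum_val i. *)
Definition commuting_matrix (gT : finGroupType) (G : {group gT}) :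
    'M[int]_#|G| :=
  \matrix_(i, j)
    (enum_val i * enum_val j == enum_val j * enum_val i)%g%:R.

Definition commuting_difference_lattice (gT : finGroupType) (G : {group gT})
    (v : 'rV[int]_#|G|) : Prop :=
  exists c : 'M[int]_#|G|,
    v = \sum_i \sum_j
          c i j *: (row i (commuting_matrix G) - row j (commuting_matrix G)).

Arguments commuting_difference_lattice {gT} G v.

Definition rows_generate (m N : nat) (B : 'M[int]_(m, N))
    (M : 'rV[int]_N -> Prop) : Prop :=
  forall v, M v <-> exists u : 'rV[int]_m, v = u *m B.

Definition seq_diag_mx (m N : nat) (a : seq nat) : 'M[int]_(m, N) :=
  \matrix_(i, j) ((nth 0%N a i)%:Z *+ (i == j :> nat)).

(* The positivity and size conditions make size a the rank of M: every entry
   of a occurs in the diagonal matrix, whose other entries are zero. *)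
Definition diagonal_presentation (N : nat) (M : 'rV[int]_N -> Prop)
    (a : seq nat) : Prop :=
  all (fun x => 0 < x)%N a /\
  exists (m : nat) (B : 'M[int]_(m, N)) (L : 'M[int]_m) (R : 'M[int]_N),
    [/\ rows_generate B M, (size a <= minn m N)%N,
        L \in unitmx, R \in unitmx & L *m B *m R = seq_diag_mx m N a].

Definition invariant_factors (N : nat) (M : 'rV[int]_N -> Prop)
    (d : seq nat) : Prop :=
  diagonal_presentation M d /\ sorted dvdn d.

Definition nontrivial (a : seq nat) : seq nat := [seq x <- a | (1 < x)%N].

Definition smith_spectrum (gT : finGroupType) (G : {group gT})
    (s : seq nat) : Prop :=
  exists2 d, invariant_factors (commuting_difference_lattice G) d
    & s = nontrivial d.

(* Main.v *)
Require Import Defs.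
From HB Require Import structures.
From mathcomp Require Import all_boot all_order all_algebra all_fingroup all_solvable.

(** Write D(G) for the commuting difference lattice of G and P for its
    commuting matrix; D(G) consists of the c P with c an integer row of
    coordinate sum 0.

    In a nonabelian CA-group two noncentral elements commute exactly when they
    have the same centralizer, and these centralizers are the b maximal abelian
    subgroups.  So P only depends on the partition of G into the center and b
    further blocks, and it can be diagonalized by a congruence: there are a
    unimodular U and a vector d with P = U diag(d) U^T.  The entries of d are 1
    for one representative of each noncentral block, 1 - b for one central
    element, and 0 elsewhere.  Moreover U d is the all-ones vector, and this is
    the point of the argument: writing y = c U diag(d), the condition that c
    has sum 0 says that y has sum 0, so that

      D(G) = { y U^T | d_j divides y_j for all j, and the y_j sum to 0 }.

    Both P = U diag(d) U^T and U d = 1 are stable under tensor products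
    (diagonal_congruence_tensor), and the commuting matrix of a direct product
    is the tensor product of the commuting matrices.  Hence D(G x H) has the
    same form, for the vector of the products d_i d'_j.  Picking an index k
    with d_k = 1 and replacing the coordinate y_k by the sum of all y_j, which
    is constrained to vanish, gives a diagonal presentation whose entries are
    the nonzero absolute values of the d_i d'_j, one entry 1 being lost
    (diagonal_congruence_coordinates).  As b >= 3, the nontrivial ones are
    those of the theorem.

    To speak of the product of the invariant factors one needs that they do
    not depend on the presentation.  If a is any diagonal presentation of M
    and p is a prime, then the number of entries of p-adic valuation at most t
    is the rank modulo p of { v | n v in M } for a suitable n of valuation t.
    This determines the multiset of the p-adic valuations of the entries
    (perm_logn_diagonal_presentation), hence their product, and the entries
    themselves when they form a divisibility chain.

    If A is abelian, its commuting matrix has all entries 1.  So D(A) = 0, and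
    D(G x A) is the set of the rows of D(G) repeated once for each element
    of A.  Subtracting one copy from the others brings such rows back to the
    coordinates of D(G) padded with zeros, so that D(G x A) inherits the
    diagonal presentations of D(G).  *)

Set Implicit Arguments.
Unset Strict Implicit.
Unset Printing Implicit Defensive.

Import Order.TTheory GRing.Theory Num.Theory.

Local Open Scope ring_scope.

(** * Diagonal presentations in coordinates *)

(** The columns of R are coordinate functions on Z^N in which membership in M
    becomes one divisibility condition per coordinate.  An entry 0 of d forces
    the coordinate to vanish, so a single formula covers lattices of any
    rank. *)
Definition diagonal_coordinates N (M : 'rV[int]_N -> Prop) (R : 'M[int]_N)
    (d : 'I_N -> int) : Prop :=
  R \in unitmx /\ forall v, M v <-> forall j, (d j %| ((v *m R) 0 j)%R)%Z.

Lemma mul_seq_diag_mx m N (a : seq nat) (u : 'rV[int]_m) (j : 'I_N) :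
  (u *m seq_diag_mx m N a) 0 j =
    \sum_(i < m | (i : nat) == j) u 0 i * (nth 0%N a j)%:Z.
Proof.
rewrite mxE [RHS]big_mkcond /=; apply: eq_bigr => i _; rewrite mxE.
by case: eqP => [->|_]; rewrite ?mulr1n ?mulr0n ?mulr0.
Qed.

Lemma diagonal_presentation_coordinates N (M : 'rV[int]_N -> Prop) a :
  diagonal_presentation M a ->
  [/\ all (fun x => 0 < x)%N a, (size a <= N)%N &
      exists R, diagonal_coordinates M R (fun j => (nth 0%N a j)%:Z)].
Proof.
case=> a_gt0 [m [B [L [R [defM sza uL uR defD]]]]].
move: sza; rewrite leq_min => /andP[szm szN]; split=> //.
exists R; split=> // v.
have LB : L *m B = seq_diag_mx m N a *m invmx R by rewrite -defD mulmxK.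
have defB : B *m R = invmx L *m seq_diag_mx m N a.
  by rewrite -defD -mulmxA mulKmx.
split=> [/defM[u ->] j | dv].
  rewrite -mulmxA defB mulmxA mul_seq_diag_mx -big_distrl /=.
  exact: dvdz_mull.
apply/defM.
pose u : 'rV_m :=
  \row_i \sum_(j < N | (i : nat) == j) (((v *m R) 0 j)%R %/ (nth 0%N a j)%:Z)%Z.
exists (u *m L); rewrite -mulmxA LB mulmxA; apply: (canRL (mulmxK uR)).
apply/rowP=> j; rewrite mul_seq_diag_mx.
have [ltjm | lemj] := ltnP j m; last first.
  move: (dv j); rewrite nth_default ?(leq_trans szm) // dvd0z => /eqP->.
  by rewrite big1 // => i _; rewrite mulr0.
rewrite (big_pred1 (Ordinal ltjm)) => [|i]; last by [].
rewrite [u _ _]mxE (big_pred1 j) => [|i]; last exact: eq_sym.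
by rewrite divzK.
Qed.

(** Sorting the coordinates by a permutation moves those with d_j = 0 to the
    end and puts the others in any prescribed order; signs are irrelevant to
    divisibility. *)
Lemma coordinates_diagonal_presentation N (M : 'rV[int]_N -> Prop) R d a :
  diagonal_coordinates M R d ->
  perm_eq a [seq `|d j|%N | j <- enum 'I_N & d j != 0] ->
  diagonal_presentation M a.
Proof.
move=> [uR defM] pa.
have pos x : x \in a -> (0 < x)%N.
  rewrite (perm_mem pa) => /mapP[j]; rewrite mem_filter => /andP[dj _ ->].
  by rewrite absz_gt0.
split; first exact/allP.
pose e := a ++ nseq (count (fun j => d j == 0) (enum 'I_N)) 0%N.
have pe : perm_eq e [tuple `|d j|%N | j < N].
  have: perm_eq ([seq j <- enum 'I_N | d j != 0] ++
                 [seq j <- enum 'I_N | d j == 0]) (enum 'I_N).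
    rewrite -(permPr (permEl (perm_filterC (fun j => d j != 0) _))) perm_cat2l.
    by rewrite (eq_filter (a2 := fun j => d j == 0)) // => j; apply: negbK.
  move/(perm_map (fun j => `|d j|%N)); rewrite map_cat.
  apply: perm_trans; apply: perm_cat => //; rewrite -size_filter.
  have: all (fun j => d j == 0) [seq j <- enum 'I_N | d j == 0].
    exact: filter_all.
  elim: [seq _ <- _ | _] => //= j s IHs /andP[/eqP-> /IHs].
  by rewrite absz0 perm_cons.
have sze : size e == N by rewrite (perm_size pe) size_tuple.
case/(@tuple_permP _ _ (Tuple sze)): (pe) => s /= es.
have nthe (i : 'I_N) : nth 0%N a i = `|d (s i)|%N.
  have ->: nth 0%N a i = nth 0%N e i.
    rewrite nth_cat; case: ltnP => // lt_ai.
    by rewrite nth_nseq if_same nth_default.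
  rewrite es (nth_map i) ?size_enum_ord // nth_ord_enum.
  by rewrite tnth_map tnth_ord_tuple.
have sza : (size a <= N)%N.
  by rewrite -(eqP sze) size_cat leq_addr.
exists N, (seq_diag_mx N N a *m invmx (col_perm s R)), 1%:M, (col_perm s R).
have uR' : col_perm s R \in unitmx.
  by rewrite col_permE unitmx_mul uR unitmx_perm.
split=> //; rewrite ?minnn ?unitmx1 ?mul1mx ?mulmxKV // => v.
have vR' (w : 'rV_N) j : (w *m col_perm s R) 0 j = (w *m R) 0 (s j).
  by rewrite !mxE; apply: eq_bigr => i _; rewrite mxE.
split=> [/defM dv | [u ->]]; last first.
  apply/defM=> j.
  rewrite -[j in (_ *m _) 0 j](permKV s) -vR' mulmxA mulmxKV //.
  rewrite mul_seq_diag_mx (big_pred1 (s^-1 j)%g) => [|i]; last by [].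
  by rewrite nthe permKV dvdzE abszM dvdn_mull.
exists (\row_j (((v *m R) 0 (s j))%R %/ (nth 0%N a j)%:Z)%Z).
rewrite mulmxA; apply: (canRL (mulmxK uR')).
apply/rowP=> j; rewrite vR' mul_seq_diag_mx (big_pred1 j) => [|i]; last by [].
by rewrite mxE divzK // nthe dvdzE; apply: (dv (s j)).
Qed.

(** * Uniqueness and existence of the invariant factors *)

(** The rows of Q with index in S are linearly independent and live in the
    coordinate subspace of dimension #|T|. *)
Lemma card_le_unitmx_support (F : fieldType) N (Q : 'M[F]_N) (S T : {set 'I_N}) :
  Q \in unitmx -> (forall j i, j \in S -> i \notin T -> Q j i = 0) ->
  (#|S| <= #|T|)%N.
Proof.
move=> uQ Q0; pose A : 'M[F]_(#|S|, N) := rowsub enum_val 1%:M.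
have rA : \rank A = #|S|.
  apply/eqP/row_freeP; exists A^T; apply/matrixP=> i j; rewrite !mxE.
  rewrite (bigD1 (enum_val i)) //= !mxE eqxx mul1r big1 ?addr0 => [|k ne].
    by rewrite (inj_eq enum_val_inj) eq_sym.
  by rewrite !mxE eq_sym (negPf ne) mul0r.
have defAQ : A *m Q = (\matrix_(i, j) Q (enum_val i) (enum_val j)) *m
    rowsub (enum_val : 'I_#|T| -> 'I_N) 1%:M.
  apply/matrixP=> i j; rewrite !mxE (bigD1 (enum_val i)) //= !mxE eqxx mul1r.
  rewrite big1 ?addr0 => [|k ne]; last first.
    by rewrite !mxE eq_sym (negPf ne) mul0r.
  have [Tj | T'j] := boolP (j \in T); last first.
    rewrite Q0 ?enum_valP // big1 // => k _; rewrite !mxE.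
    case: eqP => [jk|_]; last by rewrite mulr0.
    by rewrite -jk enum_valP in T'j.
  rewrite (bigD1 (enum_rank_in Tj j)) //= big1 ?addr0 => [|k ne].
    by rewrite !mxE enum_rankK_in // eqxx mulr1.
  rewrite !mxE; case: eqP => [jk|_]; last by rewrite mulr0.
  by case/eqP: ne; apply: enum_val_inj; rewrite enum_rankK_in.
rewrite -rA -(@mxrankMfree _ _ _ _ A Q) ?row_free_unit //.
apply: leq_trans (rank_leq_row (rowsub (enum_val : 'I_#|T| -> 'I_N) 1%:M)).
by rewrite defAQ; apply: mxrankM_maxr.
Qed.

Lemma card_nth_count N (P : pred nat) (a : seq nat) : (size a <= N)%N ->
  #|[set j : 'I_N | P (nth 0%N a j) & (j < size a)%N]| = count P a.
Proof.
move=> szN; rewrite -sum1_count -sum1_card (big_nth 0%N) big_mkord.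
rewrite (big_ord_widen_cond N (fun i => P (nth 0%N a i)) (fun=> 1%N)) //.
by apply: eq_bigl => j; rewrite inE.
Qed.

(** The lattice { v | n v in M } contains the basis vectors of the second
    presentation whose entry divides n.  In the basis of the first one, its
    members have coordinates divisible by p wherever the entry has larger
    p-adic valuation than n, and zero coordinates beyond the rank.  Reducing
    modulo p compares the two dimensions. *)
Lemma count_dvdn_diagonal_presentation N (M : 'rV[int]_N -> Prop) a a' p n :
  prime p -> (0 < n)%N ->
  diagonal_presentation M a -> diagonal_presentation M a' ->
  (count (fun x => x %| n) a' <= count (fun x => logn p x <= logn p n) a)%N.
Proof.
move=> p_pr n_gt0 /diagonal_presentation_coordinates[a_gt0 sza [R [uR defM]]].
case/diagonal_presentation_coordinates=> a'_gt0 sza' [R' [uR' defM']].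
rewrite -!(@card_nth_count N) //.
pose Q := invmx R' *m R.
have uQ : Q \in unitmx by rewrite unitmx_mul unitmx_inv uR'.
apply: (@card_le_unitmx_support 'F_p _ (map_mx intr Q)).
  by move: uQ; rewrite !unitmxE det_map_mx; apply: rmorph_unit.
move=> j i; rewrite !inE => /andP[dvd_n ltj] nTi; rewrite mxE.
apply/eqP; rewrite -(dvdz_pcharf (pchar_Fp p_pr)).
(* n times the j-th basis vector of the second presentation lies in M *)
have: (nth 0%N a i %| n * `|Q j i|)%N.
  have Mv : M (n%:Z *: delta_mx 0 j *m invmx R').
    apply/defM'=> l; rewrite mulmxKV // !mxE eqxx /= dvdzE.
    by have [->|] := eqVneq l j; rewrite ?mulr1 ?mulr0 ?dvdn0.
  have /defM/(_ i) := Mv.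
  by rewrite -mulmxA -/Q -scalemxAl mxE -rowE mxE dvdzE abszM.
rewrite dvdzE absz_nat; move: (`|Q j i|%N) => q.
have [lti | leai] := ltnP i (size a); last first.
  rewrite nth_default // dvd0n muln_eq0 => /orP[/eqP n0|/eqP->] //.
  by rewrite n0 in n_gt0.
move: nTi; rewrite lti andbT -ltnNge => lt_p dvd_nq.
have [->|q_gt0] := posnP q; first exact: dvdn0.
have := dvdn_leq_log p _ dvd_nq; rewrite muln_gt0 n_gt0 q_gt0 lognM //.
move=> /(_ isT).
move/(leq_trans lt_p); rewrite -addn1 leq_add2l => lq.
by rewrite -[p]expn1 pfactor_dvdn.
Qed.

(** Applied with n equal to p ^ t times the p'-part of all the entries, the
    previous bound no longer sees the other primes. *)
Lemma count_logn_diagonal_presentation N (M : 'rV[int]_N -> Prop) a a' p t :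
  prime p -> diagonal_presentation M a -> diagonal_presentation M a' ->
  (count (fun x => logn p x <= t) a' <= count (fun x => logn p x <= t) a)%N.
Proof.
move=> p_pr Ma Ma'.
have [/allP a'_gt0 _ _] := diagonal_presentation_coordinates Ma'.
pose A := (\prod_(x <- a') x)%N.
have A_gt0 : (0 < A)%N.
  by rewrite /A big_seq; elim/big_ind: _ => // x y; rewrite muln_gt0 => ->.
pose n := (p ^ t * A`_p^')%N.
have n_gt0 : (0 < n)%N by rewrite muln_gt0 expn_gt0 prime_gt0 // part_gt0.
have nt : logn p n = t.
  rewrite lognM ?expn_gt0 ?(prime_gt0 p_pr) ?part_gt0 // pfactorK //.
  by rewrite logn_coprime ?addn0 // prime_coprime // -p'natE // part_pnat.
have := count_dvdn_diagonal_presentation p_pr n_gt0 Ma Ma'; rewrite nt.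
apply: leq_trans.
have dvd_n x : x \in a' -> (logn p x <= t)%N -> (x %| n)%N.
  move=> a'x le_t; rewrite -(partnC p (a'_gt0 x a'x)) dvdn_mul //.
    by rewrite p_part dvdn_exp2l.
  by rewrite partn_dvd // /A (big_rem x) //= dvdn_mulr.
rewrite (eq_in_count (a2 := fun x => (x %| n) && (logn p x <= t))%N).
  by apply: sub_count => x /andP[].
move=> x a'x; rewrite andbC; case: leqP => // le_t.
by rewrite dvd_n.
Qed.

Lemma perm_eq_count_leq (s1 s2 : seq nat) :
  (forall t, count (fun x => x <= t)%N s1 = count (fun x => x <= t)%N s2) ->
  perm_eq s1 s2.
Proof.
move=> eq_s; apply/allP=> x _ /=; apply/eqP.
have cntE s t : count (fun x => x <= t.+1)%N s =
    (count (fun x => x <= t)%N s + count_mem t.+1 s)%N.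
  elim: s => //= y s ->; rewrite addnACA; congr (_ + _)%N.
  by rewrite leq_eqVlt ltnS; case: eqP => [->|_]; rewrite ?ltnn ?addn0.
case: x => [|x]; last by have := eq_s x.+1; rewrite !cntE eq_s => /addnI.
have cnt0 s : count (fun x => x <= 0)%N s = count_mem 0%N s.
  by apply: eq_count => x; apply: leqn0.
by have := eq_s 0%N; rewrite !cnt0.
Qed.

(** The p-adic valuations of the entries are an invariant of the lattice; for a
    divisibility chain they come in increasing order, so they determine every
    entry. *)
Lemma perm_logn_diagonal_presentation N (M : 'rV[int]_N -> Prop) a a' p :
  prime p -> diagonal_presentation M a -> diagonal_presentation M a' ->
  perm_eq (map (logn p) a) (map (logn p) a').
Proof.
move=> p_pr Ma Ma'; apply: perm_eq_count_leq => t; rewrite !count_map.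
apply/eqP; rewrite eqn_leq; apply/andP.
by rewrite !(@count_logn_diagonal_presentation N M).
Qed.

Lemma diagonal_presentation_prod N (M : 'rV[int]_N -> Prop) a a' :
  diagonal_presentation M a -> diagonal_presentation M a' ->
  (\prod_(x <- a) x = \prod_(x <- a') x)%N.
Proof.
move=> Ma Ma'.
have prod_gt0 (s : seq nat) :
    all (fun x => 0 < x)%N s -> (0 < \prod_(x <- s) x)%N.
  elim: s => [|x s IHs] /=; rewrite ?big_nil ?big_cons // muln_gt0.
  by case/andP=> -> /IHs.
have logn_prod p s : all (fun x => 0 < x)%N s ->
    logn p (\prod_(x <- s) x)%N = (\sum_(i <- map (logn p) s) i)%N.
  elim: s => [|x s IHs] /=; first by rewrite !big_nil logn1.
  by case/andP=> x_gt0 s_gt0; rewrite !big_cons lognM ?IHs // prod_gt0.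
case: (Ma) (Ma') => [a_gt0 _] [a'_gt0 _].
apply: eqn_from_log => [||p]; rewrite ?prod_gt0 //.
have [p_pr|np] := boolP (prime p); last by rewrite /logn !ifN.
rewrite !logn_prod //; apply: perm_big.
exact: perm_logn_diagonal_presentation Ma Ma'.
Qed.

Lemma invariant_factors_unique N (M : 'rV[int]_N -> Prop) a a' :
  invariant_factors M a -> invariant_factors M a' -> a = a'.
Proof.
case=> Ma sa [Ma' sa'].
case: (Ma) (Ma') => [/allP a_gt0 _] [/allP a'_gt0 _].
have logn_sorted p s : {in s, forall x, 0 < x}%N -> sorted dvdn s ->
    sorted leq (map (logn p) s).
  move=> s_gt0; apply: (@homo_sorted_in _ _ (mem s)); last exact/allP.
  by move=> x y _ /s_gt0 y_gt0; apply: dvdn_leq_log.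
have eq_log p : prime p -> map (logn p) a = map (logn p) a'.
  move=> p_pr; apply: (sorted_eq leq_trans anti_leq); try exact: logn_sorted.
  exact: perm_logn_diagonal_presentation Ma Ma'.
have sz : size a = size a'.
  by rewrite -(size_map (logn 2)) eq_log // size_map.
apply: (eq_from_nth (x0 := 0%N) sz) => i lti.
have lti' : (i < size a')%N by rewrite -sz.
apply: eqn_from_log => [||p].
- exact/a_gt0/mem_nth.
- exact/a'_gt0/mem_nth.
have [p_pr|np] := boolP (prime p); last by rewrite /logn !ifN.
by rewrite -!(nth_map _ 0%N) // eq_log.
Qed.

Lemma rows_generate_invariant_factors N (M : 'rV[int]_N -> Prop)
    (B : 'M[int]_N) :
  rows_generate B M -> exists a, invariant_factors M a.
Proof.
move=> defM; have [L uL [R uR [d sd defB]]] := int_Smith_normal_form B.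
pose D (j : 'I_N) : int := d`_j.
exists [seq `|D j|%N | j <- enum 'I_N & D j != 0]; split.
  apply: (@coordinates_diagonal_presentation _ _ (invmx R) D) => //.
  split=> [|v]; first by rewrite unitmx_inv.
  have mulD (u : 'rV_N) j :
      (u *m \matrix_(i < N, j < N) (d`_i *+ (i == j :> nat))) 0 j = u 0 j * d`_j.
    rewrite mxE (bigD1 j) //= mxE eqxx mulr1n big1 ?addr0 // => i ne.
    by rewrite mxE val_eqE (negPf ne) mulr0n mulr0.
  split=> [/defM[u ->] j | dv].
    by rewrite defB !mulmxA mulmxK // mulD dvdz_mull.
  apply/defM.
  exists (\row_j (((v *m invmx R) 0 j)%R %/ (d`_j)%R)%Z *m invmx L).
  rewrite defB !mulmxA mulmxKV //; apply: (canRL (mulmxKV uR)).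
  by apply/rowP=> j; rewrite mulD [in RHS]mxE divzK //; apply: dv.
have -> : [seq `|D j|%N | j <- enum 'I_N & D j != 0] =
    [seq x <- [seq `|(d`_i)%R|%N | i <- iota 0 N] | x != 0%N].
  rewrite -val_enum_ord -map_comp [RHS]filter_map; congr map.
  by apply: eq_filter => j /=; rewrite absz_eq0.
apply: sorted_filter; first exact: dvdn_trans.
apply/(sortedP 0%N) => i; rewrite size_map size_iota => lti.
rewrite !(nth_map 0%N) ?size_iota ?nth_iota // ?(ltnW lti) // !add0n.
have [lt_d | le_d] := ltnP i.+1 (size d).
  by have /(sortedP 0)/(_ i lt_d) := sd.
by rewrite [d`_i.+1]nth_default // absz0 dvdn0.
Qed.

(** * The commuting difference lattice *)

(** Every row of coordinate sum 0 is a combination of differences with one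
    fixed basis vector. *)
Lemma commuting_difference_latticeP (gT : finGroupType) (G : {group gT}) v :
  commuting_difference_lattice G v <->
  exists2 c : 'rV[int]_#|G|, \sum_j c 0 j = 0 & v = c *m commuting_matrix G.
Proof.
set P := commuting_matrix G; split=> [[c ->] | [c c0 ->]].
  exists (\row_i (\sum_j c i j - \sum_j c j i)).
    under eq_bigr do rewrite mxE.
    by rewrite sumrB [X in _ - X]exchange_big subrr.
  rewrite mulmx_sum_row.
  under [RHS]eq_bigr do rewrite mxE scalerBl !scaler_suml.
  rewrite sumrB [X in _ = _ - X]exchange_big -sumrB; apply: eq_bigr => i _.
  by rewrite -sumrB; apply: eq_bigr => j _; rewrite scalerBr.
have o : 'I_#|G| := enum_rank_in (group1 G) 1%g.
exists (\matrix_(i, j) (c 0 i *+ (j == o))).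
rewrite mulmx_sum_row.
transitivity (\sum_i c 0 i *: (row i P - row o P)).
  under [RHS]eq_bigr do rewrite scalerBr.
  by rewrite sumrB -scaler_suml c0 scale0r subr0.
apply: eq_bigr => i _; rewrite (bigD1 o) //= mxE eqxx big1 ?addr0 // => j ne.
by rewrite mxE (negPf ne) scale0r.
Qed.

Lemma commuting_difference_lattice_invariant_factors
    (gT : finGroupType) (G : {group gT}) :
  exists a, invariant_factors (commuting_difference_lattice G) a.
Proof.
set P := commuting_matrix G.
have o : 'I_#|G| := enum_rank_in (group1 G) 1%g.
(* u - u E is u made of sum 0 by a change of its coordinate o *)
pose E : 'M[int]_#|G| := \matrix_(i, j) (j == o)%:R.
have mulE (u : 'rV_#|G|) : u *m E = (\sum_j u 0 j) *: delta_mx 0 o.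
  apply/rowP=> j; rewrite !mxE eqxx /= mulr_suml.
  by apply: eq_bigr => i _; rewrite mxE.
apply: (@rows_generate_invariant_factors _ _ ((1%:M - E) *m P)) => v.
split=> [/commuting_difference_latticeP[c c0 ->] | [u ->]].
  by exists c; rewrite mulmxA mulmxBr mulmx1 mulE c0 scale0r subr0.
apply/commuting_difference_latticeP; exists (u *m (1%:M - E)); last first.
  by rewrite mulmxA.
rewrite mulmxBr mulmx1 mulE.
under eq_bigr do rewrite !mxE eqxx /=.
rewrite sumrB -mulr_sumr.
have -> : \sum_j (j == o)%:R = 1 :> int; last by rewrite mulr1 subrr.
by rewrite (bigD1 o) //= eqxx big1 ?addr0 // => j /negPf->.
Qed.

Lemma smith_spectrum_unique (gT : finGroupType) (G : {group gT}) d :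
  invariant_factors (commuting_difference_lattice G) d ->
  unique (smith_spectrum G) (nontrivial d).
Proof.
move=> invd; split=> [|s [d' invd' ->]]; first by exists d.
by rewrite (invariant_factors_unique invd invd').
Qed.

(** * Tensor products and diagonal congruences *)

Lemma unitmx_unipotent n (A : 'M[int]_n) :
  A *m A = 0 -> 1%:M + A \in unitmx.
Proof.
move=> A2; apply: (proj1 (@mulmx1_unit _ _ _ (1%:M - A) _)).
by rewrite mulmxDl !mulmxBr !mulmx1 !mul1mx A2 subr0 subrK.
Qed.

(** The Kronecker product, read through a bijection phi with the pairs of
    indices: the elements of a product group come with their own
    enumeration. *)
Definition tensor_mx N m n (phi : 'I_N -> 'I_m * 'I_n)
    (A : 'M[int]_m) (B : 'M[int]_n) : 'M[int]_N :=
  \matrix_(x, y) (A (phi x).1 (phi y).1 * B (phi x).2 (phi y).2).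

Lemma sum_tensor N m n (phi : 'I_N -> 'I_m * 'I_n) (F : 'I_m -> 'I_n -> int) :
  bijective phi ->
  \sum_x F (phi x).1 (phi x).2 = \sum_i \sum_j F i j.
Proof.
move=> bij_phi; rewrite pair_big /=.
by rewrite (reindex phi) //; apply: onW_bij.
Qed.

Lemma mul_tensor_mx N m n (phi : 'I_N -> 'I_m * 'I_n) A A' B B' :
  bijective phi ->
  tensor_mx phi A B *m tensor_mx phi A' B' = tensor_mx phi (A *m A') (B *m B').
Proof.
move=> bij_phi; apply/matrixP=> x y; rewrite !mxE big_distrlr /=.
rewrite -(sum_tensor _ bij_phi) /=.
by apply: eq_bigr => z _; rewrite !mxE mulrACA.
Qed.

Lemma tensor_mx1 N m n (phi : 'I_N -> 'I_m * 'I_n) :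
  bijective phi -> tensor_mx phi 1%:M 1%:M = 1%:M.
Proof.
move=> /bij_inj phi_inj; apply/matrixP=> x y; rewrite !mxE -natrM mulnb.
by rewrite -(inj_eq phi_inj).
Qed.

Lemma unitmx_tensor N m n (phi : 'I_N -> 'I_m * 'I_n) A B :
  bijective phi -> A \in unitmx -> B \in unitmx -> tensor_mx phi A B \in unitmx.
Proof.
move=> bij_phi uA uB.
apply: (proj1 (@mulmx1_unit _ _ _ (tensor_mx phi (invmx A) (invmx B)) _)).
by rewrite mul_tensor_mx // !mulmxV // tensor_mx1.
Qed.

(** P = U diag(d) U^T with U d = 1.  The last condition says that the row sum of
    c is the row sum of c U diag(d): the constraint that cuts out the difference
    lattice is expressed in the diagonalizing coordinates. *)
Definition diagonal_congruence n (P U : 'M[int]_n) (d : 'I_n -> int) : Prop :=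
  [/\ U \in unitmx,
      forall i j, P i j = \sum_k U i k * d k * U j k &
      forall i, \sum_k U i k * d k = 1].

Lemma diagonal_congruence_tensor N m n (phi : 'I_N -> 'I_m * 'I_n)
    P U d P' U' d' :
  bijective phi ->
  diagonal_congruence P U d -> diagonal_congruence P' U' d' ->
  diagonal_congruence (tensor_mx phi P P') (tensor_mx phi U U')
    (fun x => d (phi x).1 * d' (phi x).2).
Proof.
move=> bij_phi [uU defP Ud] [uU' defP' Ud']; split=> [|x y|x].
- exact: unitmx_tensor.
- rewrite mxE defP defP' big_distrlr /= -(sum_tensor _ bij_phi) /=.
  by apply: eq_bigr => z _; rewrite !mxE mulrACA [X in X * _]mulrACA.
have <- : (\sum_k U (phi x).1 k * d k) * (\sum_k U' (phi x).2 k * d' k) = 1.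
  by rewrite Ud Ud' mulr1.
rewrite big_distrlr /=.
rewrite -(sum_tensor _ bij_phi) /=.
by apply: eq_bigr => z _; rewrite !mxE mulrACA.
Qed.

(** In the coordinates y = v U^-T the lattice is given by d_j %| y_j and by the
    vanishing of the sum of the y_j.  Since d_k = 1, the coordinate y_k is
    otherwise unconstrained and the sum can take its place. *)
Lemma diagonal_congruence_coordinates (gT : finGroupType) (G : {group gT}) U d k :
  diagonal_congruence (commuting_matrix G) U d -> d k = 1 ->
  exists R, diagonal_coordinates (commuting_difference_lattice G) R
    (fun j => if j == k then 0 else d j).
Proof.
case=> uU defP Ud dk.
(* multiplication by 1 + E replaces coordinate k by the sum *)
pose E : 'M[int]_#|G| := \matrix_(i, j) ((i != k) && (j == k))%:R.
have E2 : E *m E = 0.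
  apply/matrixP=> i j; rewrite !mxE big1 // => l _; rewrite !mxE.
  by case: (l == k); rewrite ?andbF ?mul0r ?mulr0.
have mulE (y : 'rV_#|G|) j :
    (y *m (1%:M + E)) 0 j = if j == k then \sum_i y 0 i else y 0 j.
  rewrite mulmxDr mulmx1 mxE; have [->|ne] := eqVneq j k; last first.
    rewrite [X in _ + X]mxE big1 ?addr0 // => i _.
    by rewrite mxE (negPf ne) andbF mulr0.
  rewrite [RHS](bigD1 k) //= [X in _ + X]mxE (bigD1 k) //= mxE eqxx mulr0 add0r.
  by congr (_ + _); apply: eq_bigr => i ne; rewrite mxE ne eqxx mulr1.
have uUT : U^T \in unitmx by rewrite unitmx_tr.
have cP (c : 'rV_#|G|) :
    c *m commuting_matrix G = \row_j ((c *m U) 0 j * d j) *m U^T.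
  apply/rowP=> i; rewrite !mxE; under eq_bigr do rewrite defP mulr_sumr.
  rewrite exchange_big; apply: eq_bigr => j _; rewrite !mxE !mulr_suml.
  by apply: eq_bigr => l _; rewrite !mulrA.
have sum_cU (c : 'rV_#|G|) : \sum_j (c *m U) 0 j * d j = \sum_i c 0 i.
  under eq_bigr do rewrite mxE mulr_suml.
  rewrite exchange_big; apply: eq_bigr => i _ /=.
  by under eq_bigr do rewrite -mulrA; rewrite -mulr_sumr Ud mulr1.
exists (invmx U^T *m (1%:M + E)); split=> [|v].
  by rewrite unitmx_mul unitmx_inv uUT unitmx_unipotent.
split=> [/commuting_difference_latticeP[c c0 ->] j | dv].
  rewrite cP mulmxA mulmxK // mulE.
  under eq_bigr do rewrite mxE; rewrite sum_cU c0 mxE.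
  by case: (j == k) => //; apply: dvdz_mull.
pose y := v *m invmx U^T.
have {}dv j : ((if j == k then 0 else d j) %|
               (if j == k then \sum_i y 0 i else y 0 j)%R)%Z.
  by have := dv j; rewrite mulmxA mulE.
have dy j : (d j %| (y 0 j)%R)%Z.
  by have := dv j; have [->|//] := eqVneq j k; rewrite dk dvd1z.
have y0 : \sum_i y 0 i = 0 by have := dv k; rewrite eqxx dvd0z => /eqP.
pose z : 'rV_#|G| := \row_j ((y 0 j)%R %/ d j)%Z.
have zd j : z 0 j * d j = y 0 j by rewrite mxE divzK.
apply/commuting_difference_latticeP; exists (z *m invmx U).
  by rewrite -sum_cU mulmxKV // (eq_bigr _ (fun j _ => zd j)).
rewrite cP mulmxKV //; apply: (canRL (mulmxKV uUT)).
by apply/rowP=> j; rewrite [in RHS]mxE zd.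
Qed.

Lemma commuting_matrix_setX (gT hT : finGroupType)
    (G : {group gT}) (H : {group hT}) :
  exists2 phi : 'I_#|setX_group G H| -> 'I_#|G| * 'I_#|H|, bijective phi &
    commuting_matrix (setX_group G H) =
      tensor_mx phi (commuting_matrix G) (commuting_matrix H).
Proof.
pose phi (x : 'I_#|setX_group G H|) :=
  (enum_rank_in (group1 G) (enum_val x).1,
   enum_rank_in (group1 H) (enum_val x).2).
have inX (x : 'I_#|setX_group G H|) :
    (enum_val x).1 \in G /\ (enum_val x).2 \in H.
  have: enum_val x \in setX G H by exact: enum_valP.
  by case: (enum_val x) => g h; rewrite in_setX => /andP[].
have valphi x : (enum_val (phi x).1, enum_val (phi x).2) = enum_val x.
  by have [Gx Hx] := inX x; rewrite !enum_rankK_in // -surjective_pairing.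
exists phi.
  exists (fun ij => enum_rank_in (group1 (setX_group G H))
                      (enum_val ij.1, enum_val ij.2)) => [x | [i j]].
    by rewrite valphi enum_valK_in.
  have Xij : (enum_val i, enum_val j) \in setX_group G H.
    by rewrite in_setX !enum_valP.
  by rewrite /phi enum_rankK_in //= !enum_valK_in.
apply/matrixP=> x y; rewrite !mxE -!valphi -natrM mulnb.
by congr (_%:R).
Qed.

(** * Matrices of a partition with a central block *)

(** The blocks are the fibers of f, the one over o being central.  The matrix
    with entry 1 when i or j is central or when they are in the same block, and
    0 otherwise, is diagonalized as follows.  W has one
    representative in each noncentral block, and z0 represents the central
    block.  The columns of U with index in W are the corresponding columns
    of the matrix, column z0 is the indicator of the central block, and the other
    columns are unit vectors.  Summing over k in W the product of the entries
    (i, k) and (j, k) of the matrix gives its entry (i, j), except that it gives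
    b instead of 1 when i and j are both central; the entry 1 - b of d at z0
    corrects this. *)
Section Partition.

Variables (n : nat) (T : finType) (f : 'I_n -> T) (o : T) (z : 'I_n).
Hypothesis fz : f z = o.

Let rep i := odflt i [pick j | f j == f i].
Let W := [set y | (rep y == y) && (f y != o)].
Let b := #|f @: setT :\ o|.
Let z0 := rep z.

Let f_rep i : f (rep i) = f i.
Proof. by rewrite /rep; case: pickP => [j /eqP|]. Qed.

Let eq_rep i j : (rep i == rep j) = (f i == f j).
Proof.
apply/eqP/eqP=> [|eq_f]; first by move/(congr1 f); rewrite !f_rep.
rewrite /rep eq_f; case: pickP => // /(_ j).
by rewrite eqxx.
Qed.

Let rep_id i : rep (rep i) = rep i.
Proof. by apply/eqP; rewrite eq_rep f_rep. Qed.

Let card_W : #|W| = b.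
Proof.
rewrite /b -(card_in_imset (f := f) (D := W)).
  congr #|pred_of_set _|; apply/setP=> t; rewrite !inE.
  apply/imsetP/andP=> [[y]|[to /imsetP[y _ def_t]]].
    by rewrite inE => /andP[_ fyo] ->; split=> //; apply: imset_f.
  by exists (rep y); rewrite ?inE ?rep_id ?f_rep ?eqxx -?def_t.
move=> x y; rewrite !inE => /andP[/eqP<- _] /andP[/eqP<- _].
by rewrite !f_rep => /eqP; rewrite -eq_rep => /eqP.
Qed.

Let sum_W1 : \sum_(k in W) 1 = b%:Z.
Proof. by rewrite sumr_const card_W natz. Qed.

Let U : 'M[int]_n := \matrix_(x, y)
  (if y == z0 then f x == o
   else if y \in W then (f x == f y) || (f x == o) else x == y)%:R.

Let d y : int := if y == z0 then 1 - b%:Z else (y \in W)%:R.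

Let z0W : z0 \notin W. Proof. by rewrite inE f_rep fz eqxx andbF. Qed.

(* U = (1 + A) (1 + E), where left multiplication by 1 + A adds the row of the
   representative to every other row of a block, and E has its only nonzero
   row at z0; both A and E have square zero. *)
Let unit_U : U \in unitmx.
Proof.
pose A : 'M[int]_n := \matrix_(x, y) ((rep x == y) && (x != y))%:R.
pose E : 'M[int]_n := \matrix_(x, y) ((x == z0) && (y \in W))%:R.
have A2 : A *m A = 0.
  apply/matrixP=> x y; rewrite !mxE big1 // => k _; rewrite !mxE -natrM mulnb.
  by case: eqP => //= <-; rewrite rep_id; case: (rep x == y); rewrite ?andbF.
have E2 : E *m E = 0.
  apply/matrixP=> x y; rewrite !mxE big1 // => k _; rewrite !mxE -natrM mulnb.
  by case: eqP => //= _; case: eqP => [->|]; rewrite ?(negPf z0W) ?andbF.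
suff -> : U = (1%:M + A) *m (1%:M + E).
  by rewrite unitmx_mul !unitmx_unipotent.
have z0E x : (rep x == z0) = (f x == o) by rewrite eq_rep fz.
rewrite mulmxDl mul1mx mulmxDr mulmx1.
apply/matrixP=> x y; rewrite !mxE.
rewrite (bigD1 z0) //= big1 ?addr0 => [|k ne]; last first.
  by rewrite !mxE (negPf ne) mulr0.
rewrite !mxE eqxx /= -z0E.
have [->|ny] := eqVneq y z0.
  rewrite (negPf z0W) andbF !addr0 mulr0 addr0.
  have [->|nx] := eqVneq x z0; first by rewrite rep_id eqxx.
  by rewrite add0r andbT.
have [Wy|nWy] := boolP (y \in W).
  move: (Wy); rewrite inE => /andP[/eqP ry fyo].
  rewrite -eq_rep ry; have [->|nx] := eqVneq x z0.
    by rewrite rep_id (eq_sym z0 y) (negPf ny) eqxx.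
  have [eqx|nrx] := eqVneq (rep x) y.
    by rewrite eqx (negPf ny); case: (x == y).
  have [exy|_] := eqVneq x y; first by rewrite exy ry eqxx in nrx.
  by case: (rep x == z0).
rewrite andbF mulr0 !addr0.
have [exy|nxy] := eqVneq x y; first by rewrite andbF addr0.
rewrite andbT add0r; case: eqP => // rxy.
have [fyo|fyo] := eqVneq (f y) o.
  by move: (z0E y); rewrite fyo eqxx -rxy rep_id rxy (negPf ny).
by rewrite inE -rxy rep_id eqxx f_rep -(f_rep x) rxy fyo in nWy.
Qed.

Let sum_Ud i (F : 'I_n -> int) :
  \sum_k U i k * d k * F k =
    if f i == o then (1 - b%:Z) * F z0 + \sum_(k in W) F k else F (rep i).
Proof.
rewrite (bigD1 z0) //= {1}/d eqxx mxE eqxx.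
have -> : \sum_(k | k != z0) U i k * d k * F k =
          \sum_(k in W) ((f i == f k) || (f i == o))%:R * F k.
  rewrite big_mkcond [RHS]big_mkcond; apply: eq_bigr => k _ /=.
  have [->|nk] := eqVneq k z0; first by rewrite (negPf z0W).
  rewrite /d mxE (negPf nk) /=.
  by case: (k \in W); rewrite ?mulr1 // mulr0 mul0r.
case: eqP => [fi|/eqP fi].
  by rewrite mul1r; congr (_ + _); apply: eq_bigr => k _; rewrite orbT mul1r.
rewrite mul0r mul0r add0r (bigD1 (rep i)) /=; last first.
  by rewrite inE rep_id f_rep eqxx.
rewrite f_rep eqxx mul1r big1 ?addr0 // => k /andP[].
rewrite inE => /andP[/eqP rk _]; rewrite -rk -eq_rep rep_id.
by rewrite eq_sym => /negPf->; rewrite mul0r.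
Qed.

Lemma partition_diagonal_congruence (P : 'M[int]_n) :
  (forall i j, P i j = [|| f i == o, f j == o | f i == f j]%:R) ->
  exists U d, diagonal_congruence P U d /\
    perm_eq [seq d j | j <- enum 'I_n]
      (nseq b 1 ++ (1 - b%:Z) :: nseq (n - b.+1) 0).
Proof.
move=> defP; exists U, d; split; first split=> [|i j|i].
- exact: unit_U.
- rewrite defP sum_Ud.
  have UW k : k \in W -> U j k = ((f j == f k) || (f j == o))%:R.
    by move=> Wk; rewrite mxE Wk ifN //; apply: contraTneq Wk => ->.
  have [fi|fi] /= := eqVneq (f i) o; last first.
    by rewrite UW ?inE ?rep_id ?eqxx f_rep // orbC eq_sym.
  rewrite (eq_bigr _ UW) mxE eqxx.
  have [fj|fj] := eqVneq (f j) o.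
    under eq_bigr do rewrite orbT.
    by rewrite sum_W1 mulr1 subrK.
  rewrite mulr0 add0r (bigD1 (rep j)) /=; last first.
    by rewrite inE rep_id f_rep eqxx.
  rewrite f_rep eqxx big1 ?addr0 // => k /andP[].
  rewrite inE => /andP[/eqP rk _]; rewrite -rk -eq_rep rep_id orbF.
  by rewrite eq_sym => /negPf->.
- under eq_bigr do rewrite -[_ * _]mulr1.
  by rewrite sum_Ud sum_W1 mulr1 subrK if_same.
pose V := ~: (z0 |: W).
have map_const (A : {set 'I_n}) c : (forall y, y \in A -> d y = c) ->
    [seq d y | y <- enum A] = nseq #|A| c.
  move=> dc; rewrite cardE.
  have: all [pred y | d y == c] (enum A).
    by apply/allP=> y; rewrite mem_enum => /dc/eqP.
  by elim: (enum A) => //= y s IHs /andP[/eqP-> /IHs->].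
have pE : perm_eq (enum 'I_n) (enum W ++ z0 :: enum V).
  apply: uniq_perm; first exact: enum_uniq.
    rewrite cat_uniq /= !enum_uniq !mem_enum /= andbT negb_or z0W.
    apply/andP; split; last by rewrite in_setC in_setU1 eqxx.
    apply/hasPn=> y; rewrite !mem_enum in_setC in_setU1 negb_or.
    by case/andP.
  move=> y; rewrite mem_cat in_cons !mem_enum in_setC in_setU1 /=.
  by case: (y \in W); case: (y == z0).
have cV : #|V| = (n - b.+1)%N.
  by rewrite cardsCs setCK cardsU1 z0W card_W card_ord.
apply: perm_trans (perm_map d pE) _; rewrite map_cat /= {2}/d eqxx -cV -card_W.
rewrite (map_const W 1) ?(map_const V 0) // => y Ay; rewrite /d.
  by move: Ay; rewrite in_setC in_setU1 negb_or => /andP[/negPf-> /negPf->].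
by rewrite Ay ifN //; apply: contraTneq Ay => ->.
Qed.

End Partition.

(** * Nonabelian CA-groups *)

Section CAGroups.

Local Open Scope group_scope.

Variables (gT : finGroupType) (G : {group gT}).
Hypotheses (caG : CA_group G) (nabG : ~~ abelian G).

Implicit Types x y : gT.

Let mem_centr x y : x \in G -> y \in G -> (y \in 'C_G[x]) = (x * y == y * x).
Proof.
by move=> Gx Gy; rewrite inE Gy /=; apply/cent1P/eqP=> /esym.
Qed.

Let centr_full x : x \in G -> ('C_G[x] == G) = (x \in 'Z(G)).
Proof.
move=> Gx; rewrite inE Gx /= -sub_cent1.
by apply/eqP/setIidPl.
Qed.

Let abelian_centr x : x \in G -> 'C_G[x] != G -> abelian 'C_G[x].
Proof.
by move=> Gx; rewrite centr_full // => nZx; apply: caG; rewrite inE nZx.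
Qed.

Let centr_id x : x \in G -> x \in 'C_G[x].
Proof. by move=> Gx; rewrite mem_centr. Qed.

Let sub_centr x y : x \in G -> y \in G -> 'C_G[x] != G -> y \in 'C_G[x] ->
  'C_G[x] \subset 'C_G[y].
Proof.
move=> Gx Gy ncx cxy; apply/subsetP=> u cxu.
have [Gu _] := setIP cxu; rewrite mem_centr //; apply/eqP.
exact: (centsP (abelian_centr Gx ncx)).
Qed.

Lemma CA_commute x y : x \in G -> y \in G ->
  (x * y == y * x) = [|| 'C_G[x] == G, 'C_G[y] == G | 'C_G[x] == 'C_G[y]].
Proof.
move=> Gx Gy; have [ex | nx] /= := eqVneq 'C_G[x] G.
  by rewrite -mem_centr // ex.
have [ey | ny] /= := eqVneq 'C_G[y] G.
  by rewrite eq_sym -mem_centr // ey.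
apply/idP/eqP=> [cxy | exy]; last by rewrite -mem_centr // exy centr_id.
apply/eqP; rewrite eqEsubset !sub_centr ?mem_centr //.
by rewrite eq_sym.
Qed.

(** A maximal abelian subgroup contains the center, strictly because G is not
    abelian, and it is the centralizer of any of its noncentral elements. *)
Lemma CA_max_abelian_subgroups (A : {group gT}) :
  (A \in max_abelian_subgroups G) =
    (A \in [set 'C_G[x]%G | x in G] :\ G).
Proof.
rewrite !inE; apply/idP/andP=> [|[neA /imsetP[x Gx defA]]]; last first.
  have ncx: 'C_G[x] != G.
    by apply: contra neA => /eqP e; rewrite defA -val_eqE /= e.
  rewrite defA; apply/maxgroupP; rewrite subsetIl abelian_centr //; split=> // H.
  case/andP=> sHG abH sCH.
  apply/eqP.
  rewrite eqEsubset sCH andbT subsetI sHG sub_cent1.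
  by rewrite (subsetP abH) // (subsetP sCH) // centr_id.
case/maxgroupP=> /andP[sAG abA] maxA.
have [x Ax ncx]: exists2 x, x \in A & 'C_G[x] != G.
  apply/exists_inP; apply: contraR nabG; rewrite negb_exists_in.
  move=> /forall_inP cA.
  have sAZ : A \subset 'Z(G).
    apply/subsetP=> x Ax; rewrite -centr_full ?(subsetP sAG) //.
    by have := cA x Ax; rewrite negbK.
  apply/subsetP=> x Gx; apply/centP=> y Gy.
  have [exG|ncx] := eqVneq 'C_G[x] G.
    apply/eqP; rewrite -mem_centr // exG; exact: Gy.
  have defA : 'C_G[x] = A.
    apply: maxA; first by rewrite subsetIl abelian_centr.
    rewrite subsetI sAG; apply: subset_trans sAZ _.
    by rewrite sub_cent1 (subsetP _ x Gx) // centsC subsetIr.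
  have := subsetP sAZ x; rewrite -defA centr_id // -centr_full // => /(_ isT).
  by rewrite (negPf ncx).
have Gx := subsetP sAG x Ax.
have defA : 'C_G[x] = A.
  apply: maxA; first by rewrite subsetIl abelian_centr.
  by rewrite subsetI sAG sub_cent1 (subsetP abA).
have -> : A = 'C_G[x]%G by apply: group_inj; rewrite /= defA.
split; last exact: imset_f.
by apply: contra ncx => /eqP/(congr1 val)/= ->.
Qed.

(** If x and y do not commute, no two of x, y, x * y do, so their centralizers
    are three distinct maximal abelian subgroups.  The bound makes b - 1 a
    nontrivial entry. *)
Lemma CA_card_max_abelian_subgroups : (2 < #|max_abelian_subgroups G|)%N.
Proof.
have /subsetPn[x Gx] := nabG; rewrite -sub_cent1 => /subsetPn[y Gy ncy].
have nxy : x * y != y * x by rewrite -mem_centr // inE Gy.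
have Gxy : x * y \in G by rewrite groupM.
have nx_xy : x * (x * y) != x * y * x.
  by rewrite -!mulgA (inj_eq (mulgI x)).
have ny_xy : y * (x * y) != x * y * y.
  by rewrite mulgA (inj_eq (mulIg y)) eq_sym.
move: nxy nx_xy ny_xy; rewrite !CA_commute // !negb_or.
case/and3P=> nx ny nxy /and3P[_ nz nxz] /and3P[_ _ nyz].
have inM u : u \in G -> 'C_G[u] != G -> 'C_G[u]%G \in max_abelian_subgroups G.
  move=> Gu ncu; rewrite CA_max_abelian_subgroups in_setD1.
  rewrite (imset_f (fun v => 'C_G[v]%G) Gu) andbT.
  by apply: contra ncu => /eqP/(congr1 val)/= ->.
apply/card_gt2P; exists 'C_G[x]%G, 'C_G[y]%G, 'C_G[x * y]%G.
by split; split; rewrite ?inM // -val_eqE //= eq_sym.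
Qed.

End CAGroups.

(** * Products of two CA-groups *)

(** The blocks are the fibers of the centralizer map, the central one being the
    fiber of G itself. *)
Lemma CA_diagonal_congruence (gT : finGroupType) (G : {group gT}) :
  CA_group G -> ~~ abelian G ->
  let b := #|max_abelian_subgroups G| in
  exists U d, diagonal_congruence (commuting_matrix G) U d /\
    perm_eq [seq `|d j|%N | j <- enum 'I_#|G|]
      (nseq b 1%N ++ (b - 1)%N :: nseq (#|G| - b.+1) 0%N) /\
    exists k, d k = 1.
Proof.
move=> caG nabG b.
pose f (i : 'I_#|G|) := 'C_G[enum_val i]%G.
have fG : f (enum_rank_in (group1 G) 1%g) = G.
  by apply: group_inj; rewrite /f /= enum_rankK_in // cent11T setIT.
have defb : #|f @: setT :\ G| = b.
  congr #|pred_of_set _|; apply/setP=> A.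
  rewrite CA_max_abelian_subgroups // !in_setD1; congr (_ && _).
  apply/imsetP/imsetP=> [[i _ ->] | [x Gx ->]].
    by exists (enum_val i); rewrite ?enum_valP.
  by exists (enum_rank_in Gx x); rewrite /f ?enum_rankK_in.
case: (@partition_diagonal_congruence _ _ f G _ fG (commuting_matrix G)).
  by move=> i j; rewrite mxE (CA_commute caG) ?enum_valP.
move=> U [d [Ud pd]]; rewrite defb in pd.
have b_gt2 : (2 < b)%N := CA_card_max_abelian_subgroups caG nabG.
have b_gt0 : (0 < b)%N := ltnW (ltnW b_gt2).
exists U, d; split=> //; split.
  rewrite (map_comp absz d); apply: perm_trans (perm_map absz pd) _.
  rewrite map_cat /= !map_nseq perm_cat2l.
  by rewrite -abszN opprB subzn // absz_nat.
have : 1 \in [seq d j | j <- enum 'I_#|G|].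
  by rewrite (perm_mem pd) mem_cat mem_nseq b_gt0 eqxx.
by case/mapP=> k _ ->; exists k.
Qed.

Lemma sum_nseq (n c : nat) (F : nat -> nat) :
  (\sum_(x <- nseq n c) F x = n * F c)%N.
Proof. by rewrite big_nseq iter_addn_0 mulnC. Qed.

Lemma perm_nontrivial_allpairs b r m b' r' m' : (1 < m)%N -> (1 < m')%N ->
  perm_eq
    (nontrivial [seq (x * y)%N | x <- nseq b 1%N ++ m :: nseq r 0%N,
                                 y <- nseq b' 1%N ++ m' :: nseq r' 0%N])
    (nseq b' m ++ nseq b m' ++ [:: (m * m')%N]).
Proof.
move=> m1 m'1; apply/seq.permP=> P.
rewrite /nontrivial count_filter -sum1_count big_mkcond big_allpairs_dep /=.
rewrite !big_cat /= !big_cons !sum_nseq.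
rewrite !big_cat /= !big_cons !sum_nseq.
rewrite !count_cat !count_nseq /=.
have mm'1 : (1 < m * m')%N by rewrite (leq_trans m1) // leq_pmulr // ltnW.
rewrite !mul1n !mul0n !muln1 !muln0 m1 m'1 mm'1 /= !andbF !andbT.
by rewrite !muln0 !addn0 !add0n addnCA (mulnC b) (mulnC b').
Qed.

Lemma nontrivial_prod (s : seq nat) : all (fun x => 0 < x)%N s ->
  (\prod_(x <- nontrivial s) x = \prod_(x <- s) x)%N.
Proof.
move=> /allP s_gt0; rewrite big_filter [RHS](bigID (fun x => 1 < x)%N) /=.
rewrite [X in (_ * X)%N]big1_seq ?muln1 // => x /andP[x1 /s_gt0 x0].
by apply/eqP; rewrite eqn_leq leqNgt x1.
Qed.

(** The coordinate given up to the sum constraint carries an entry 1. *)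
Lemma nontrivial_erase (I : eqType) (s : seq I) (d : I -> int) l : d l = 1 ->
  nontrivial [seq `|(if j == l then 0 else d j)%R|%N
               | j <- s & (if j == l then 0 else d j)%R != 0] =
  nontrivial [seq `|d j|%N | j <- s].
Proof.
rewrite /nontrivial => dl; elim: s => //= j s IHs.
have [->|/negPf nj] := eqVneq j l.
  by rewrite eqxx dl /=.
by have [->|_] := eqVneq (d j) 0; rewrite /= ?nj IHs.
Qed.

Lemma CA_setX_diagonal_presentation (gT hT : finGroupType)
    (G : {group gT}) (H : {group hT}) :
  CA_group G -> ~~ abelian G -> CA_group H -> ~~ abelian H ->
  let bG := #|max_abelian_subgroups G| in
  let bH := #|max_abelian_subgroups H| in
  exists2 a : seq nat,
    diagonal_presentation (commuting_difference_lattice (setX_group G H)) a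
  & perm_eq (nontrivial a)
      (nseq bH (bG - 1)%N ++ nseq bG (bH - 1)%N ++ [:: ((bG - 1) * (bH - 1))%N]).
Proof.
move=> caG nabG caH nabH bG bH.
have [U [d [Ud [pd [k dk]]]]] := CA_diagonal_congruence caG nabG.
have [U' [d' [Ud' [pd' [k' dk']]]]] := CA_diagonal_congruence caH nabH.
have [phi bij_phi defX] := commuting_matrix_setX G H.
pose D x := d (phi x).1 * d' (phi x).2.
have XD := diagonal_congruence_tensor bij_phi Ud Ud'; rewrite -defX -/D in XD.
have [phi' phiK phi'K] := bij_phi.
pose l := phi' (k, k').
have Dl : D l = 1 by rewrite /D /l phi'K dk dk' mulr1.
have [R cR] := diagonal_congruence_coordinates XD Dl.
exists [seq `|(if j == l then 0 else D j)%R|%N | j <- enum 'I_#|setX_group G H|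
         & (if j == l then 0 else D j)%R != 0].
  exact: coordinates_diagonal_presentation cR (perm_refl _).
have b_gt2 := CA_card_max_abelian_subgroups caG nabG.
have b'_gt2 := CA_card_max_abelian_subgroups caH nabH.
rewrite -/bG in b_gt2 pd *; rewrite -/bH in b'_gt2 pd' *.
have m1 : (1 < bG - 1)%N by rewrite ltn_subRL.
have m'1 : (1 < bH - 1)%N by rewrite ltn_subRL.
apply: perm_trans (perm_nontrivial_allpairs
  _ (#|G| - bG.+1) _ (#|H| - bH.+1) m1 m'1).
have -> : nontrivial [seq `|(if j == l then 0 else D j)%R|%N
    | j <- enum 'I_#|setX_group G H| & (if j == l then 0 else D j)%R != 0] =
    nontrivial [seq `|D j|%N | j <- enum 'I_#|setX_group G H|].
  exact: nontrivial_erase.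
apply: perm_filter.
have -> : [seq `|D j|%N | j <- enum 'I_#|setX_group G H|] =
    [seq (`|d p.1| * `|d' p.2|)%N | p <- map phi (enum 'I_#|setX_group G H|)].
  by rewrite -map_comp; apply: eq_map => j; rewrite /= abszM.
have pphi : perm_eq (map phi (enum 'I_#|setX_group G H|))
    [seq (i, j) | i <- enum 'I_#|G|, j <- enum 'I_#|H|].
  apply: uniq_perm.
  - by rewrite map_inj_uniq ?enum_uniq //; apply: bij_inj.
  - by apply: allpairs_uniq; rewrite ?enum_uniq // => -[? ?] [? ?].
  move=> [i j]; apply/mapP/allpairsP => [_ | _].
    by exists (i, j); rewrite !mem_enum.
  by exists (phi' (i, j)); rewrite ?mem_enum ?phi'K.
apply: perm_trans (perm_map _ pphi) _.
rewrite map_allpairs /=.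
have -> : [seq (`|d i| * `|d' j|)%N | i <- enum 'I_#|G|, j <- enum 'I_#|H|] =
    [seq (x * y)%N | x <- [seq `|d i|%N | i <- enum 'I_#|G|],
                     y <- [seq `|d' i|%N | i <- enum 'I_#|H|]].
  by rewrite allpairs_mapl allpairs_mapr.
exact: perm_allpairs.
Qed.

(** * Products with an abelian group *)

Lemma commuting_matrix_abelian (aT : finGroupType) (A : {group aT}) i j :
  abelian A -> commuting_matrix A i j = 1.
Proof.
by move=> abA; rewrite mxE (centsP abA _ (enum_valP i) _ (enum_valP j)) eqxx.
Qed.

Lemma abelian_commuting_difference_lattice (aT : finGroupType)
    (A : {group aT}) v :
  abelian A -> commuting_difference_lattice A v <-> v = 0.
Proof.
move=> abA; split=> [/commuting_difference_latticeP[c c0 ->] | ->].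
  apply/rowP=> j; rewrite !mxE -[RHS]c0; apply: eq_bigr => i _.
  by rewrite commuting_matrix_abelian // mulr1.
apply/commuting_difference_latticeP; exists 0; last by rewrite mul0mx.
by rewrite big1 // => j _; rewrite mxE.
Qed.

Lemma setX_abelian_commuting_difference_lattice (gT aT : finGroupType)
    (G : {group gT}) (A : {group aT}) : abelian A ->
  exists2 phi : 'I_#|setX_group G A| -> 'I_#|G| * 'I_#|A|, bijective phi &
    forall w, commuting_difference_lattice (setX_group G A) w <->
      exists2 v, commuting_difference_lattice G v
               & forall x, w 0 x = v 0 (phi x).1.
Proof.
move=> abA; have [phi bij_phi defX] := commuting_matrix_setX G A.
exists phi => // w; have [phi' phiK phi'K] := bij_phi.
have XE x y : commuting_matrix (setX_group G A) x y =
    commuting_matrix G (phi x).1 (phi y).1.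
  by rewrite defX mxE (commuting_matrix_abelian _ _ abA) mulr1.
split=> [/commuting_difference_latticeP[c c0 ->] | ].
  pose c' : 'rV_#|G| := \row_i \sum_(j < #|A|) c 0 (phi' (i, j)).
  have sumc' F : \sum_i c' 0 i * F i = \sum_x c 0 x * F (phi x).1.
    rewrite (eq_bigr (fun x => c 0 (phi' ((phi x).1, (phi x).2)) * F (phi x).1)).
      rewrite (sum_tensor (fun i j => c 0 (phi' (i, j)) * F i) bij_phi).
      by apply: eq_bigr => i _; rewrite mxE mulr_suml.
    by move=> x _; rewrite -surjective_pairing phiK.
  exists (c' *m commuting_matrix G).
    apply/commuting_difference_latticeP; exists c' => //.
    under eq_bigr do rewrite -[c' _ _]mulr1.
    by rewrite (sumc' (fun=> 1)); under eq_bigr do rewrite mulr1.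
  move=> x; rewrite !mxE (sumc' (commuting_matrix G ^~ (phi x).1)).
  by apply: eq_bigr => y _; rewrite XE.
case=> _ /commuting_difference_latticeP[c c0 ->] wE.
have t : 'I_#|A| := enum_rank_in (group1 A) 1%g.
pose c' : 'rV_#|setX_group G A| := \row_x (c 0 (phi x).1 *+ ((phi x).2 == t)).
have sumc' F : \sum_x c' 0 x * F (phi x).1 = \sum_i c 0 i * F i.
  under eq_bigr do rewrite mxE.
  rewrite (sum_tensor (fun i j => (c 0 i *+ (j == t)) * F i) bij_phi).
  apply: eq_bigr => i _; rewrite (bigD1 t) //= eqxx big1 ?addr0 // => j ne.
  by rewrite (negPf ne) mul0r.
apply/commuting_difference_latticeP; exists c'.
  under eq_bigr do rewrite -[c' _ _]mulr1.
  by rewrite (sumc' (fun=> 1)); under eq_bigr do rewrite mulr1.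
apply/rowP=> x; rewrite wE !mxE -(sumc' (commuting_matrix G ^~ (phi x).1)).
by apply: eq_bigr => y _; rewrite XE.
Qed.

Lemma filter_nth_ord n (a : seq nat) :
  all (fun x => 0 < x)%N a -> (size a <= n)%N ->
  [seq x <- [seq nth 0%N a (i : 'I_n) | i <- enum 'I_n] | x != 0%N] = a.
Proof.
move=> a_gt0 sza.
rewrite (map_comp (nth 0%N a) val) val_enum_ord -(subnKC sza) iotaD map_cat.
rewrite map_nth_iota0 // take_size filter_cat.
rewrite (all_filterP _); last by apply: sub_all a_gt0 => x; rewrite lt0n.
rewrite -[RHS]cats0; congr (_ ++ _); apply/eqP; rewrite -size_eq0 size_filter.
rewrite -leqn0 leqNgt -has_count; apply/hasPn=> x /mapP[i].
by rewrite mem_iota => /andP[le_i _] ->; rewrite nth_default.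
Qed.

(** An element w of the lattice of G x A is a row v of the lattice of G, repeated
    for each element of A.  Subtracting the copy at t from all the others is
    unimodular, and leaves v at t and zero elsewhere. *)
Lemma diagonal_presentation_setX_abelian (gT aT : finGroupType)
    (G : {group gT}) (A : {group aT}) a : abelian A ->
  diagonal_presentation (commuting_difference_lattice G) a ->
  diagonal_presentation (commuting_difference_lattice (setX_group G A)) a.
Proof.
move=> abA /diagonal_presentation_coordinates[a_gt0 sza [R [uR defM]]].
have [phi bij_phi defX] := setX_abelian_commuting_difference_lattice G abA.
have [phi' phiK phi'K] := bij_phi.
have t : 'I_#|A| := enum_rank_in (group1 A) 1%g.
pose E : 'M[int]_#|A| := \matrix_(i, j) (- ((i == t) && (j != t))%:R).
pose W := 1%:M + E.
have uW : W \in unitmx.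
  apply: unitmx_unipotent; apply/matrixP=> i j; rewrite !mxE big1 // => k _.
  by rewrite !mxE; case: (k == t); rewrite ?andbF ?oppr0 ?mul0r ?mulr0.
have WE s j : W s j = (s == j)%:R - ((s == t) && (j != t))%:R by rewrite !mxE.
pose d x : int := if (phi x).2 == t then (nth 0%N a (phi x).1)%:Z else 0.
have mulRW (w : 'rV_#|setX_group G A|) x : (w *m tensor_mx phi R W) 0 x =
    \sum_i (\sum_s w 0 (phi' (i, s)) * W s (phi x).2) * R i (phi x).1.
  rewrite mxE; under [RHS]eq_bigr do rewrite mulr_suml.
  rewrite -(sum_tensor (fun i s => w 0 (phi' (i, s)) * W s (phi x).2
                                   * R i (phi x).1) bij_phi).
  by apply: eq_bigr => y _; rewrite -surjective_pairing phiK mxE mulrAC -mulrA.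
have sumW (F : 'I_#|A| -> int) j :
    \sum_s F s * W s j = F j - (if j == t then 0 else F t).
  under eq_bigr do rewrite WE mulrBr.
  rewrite sumrB; congr (_ - _).
    rewrite (bigD1 j) //= eqxx mulr1 big1 ?addr0 // => s ne.
    by rewrite (negPf ne) mulr0.
  have [_|_] := eqVneq j t.
    by rewrite big1 // => s _; rewrite andbF mulr0.
  rewrite (bigD1 t) //= eqxx mulr1 big1 ?addr0 // => s ne.
  by rewrite (negPf ne) mulr0.
have mulRWE (w : 'rV_#|setX_group G A|) x : (w *m tensor_mx phi R W) 0 x =
    ((\row_i (w 0 (phi' (i, (phi x).2)) -
              if (phi x).2 == t then 0 else w 0 (phi' (i, t)))) *m R) 0 (phi x).1.
  by rewrite mulRW mxE; apply: eq_bigr => i _; rewrite sumW mxE.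
apply: (@coordinates_diagonal_presentation _ _ (tensor_mx phi R W) d).
  split=> [|w]; first exact: unitmx_tensor.
  split=> [/defX[v /defM dv wv] x | dw].
    rewrite mulRWE /d; case: eqP => [->|_].
      rewrite (_ : \row_i _ = v) //; apply/rowP=> i.
      by rewrite mxE wv phi'K subr0.
    rewrite (_ : \row_i _ = 0) ?mul0mx ?mxE //; apply/rowP=> i.
    by rewrite !mxE !wv !phi'K subrr.
  pose v : 'rV_#|G| := \row_i w 0 (phi' (i, t)).
  apply/defX; exists v.
    apply/defM=> j; have := dw (phi' (j, t)); rewrite mulRWE /d phi'K /= eqxx.
    by rewrite (_ : \row_i _ = v) //; apply/rowP=> i; rewrite !mxE subr0.
  move=> x; rewrite mxE; have [<-|nx] := eqVneq (phi x).2 t.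
    by rewrite -surjective_pairing phiK.
  pose u : 'rV_#|G| := \row_i (w 0 (phi' (i, (phi x).2)) - w 0 (phi' (i, t))).
  have : u *m R = 0.
    apply/rowP=> j; rewrite [RHS]mxE; apply/eqP; rewrite -dvd0z.
    have := dw (phi' (j, (phi x).2)); rewrite mulRWE /d phi'K /= (negPf nx).
    by [].
  move/(canRL (mulmxK uR)); rewrite mul0mx => /rowP/(_ (phi x).1).
  by rewrite !mxE -surjective_pairing phiK => /eqP; rewrite subr_eq0 => /eqP.
rewrite -{1}(@filter_nth_ord #|G| a) // filter_map.
have ->: [seq `|d x|%N | x <- enum 'I_#|setX_group G A| & d x != 0] =
   [seq nth 0%N a (phi x).1 | x <- enum 'I_#|setX_group G A| & d x != 0].
  apply/eq_in_map => x; rewrite mem_filter /d => /andP[].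
  by case: ((phi x).2 == t) => // _ _; rewrite absz_nat.
rewrite perm_sym.
pose s := [seq phi' (j, t) | j <- filter (fun j : 'I_#|G| => nth 0%N a j != 0%N)
                                         (enum 'I_#|G|)].
have ps : perm_eq [seq x <- enum 'I_#|setX_group G A| | d x != 0] s.
  apply: uniq_perm.
  - by rewrite filter_uniq ?enum_uniq.
  - rewrite map_inj_uniq; first exact/filter_uniq/enum_uniq.
    by move=> i j /(can_inj phi'K)[].
  move=> x; rewrite mem_filter mem_enum andbT /d; apply/idP/mapP=> [|[j]].
    have [xt ax|_] := eqVneq (phi x).2 t; last by rewrite eqxx.
    exists (phi x).1; last first.
      by rewrite -xt -surjective_pairing phiK.
    by rewrite mem_filter mem_enum andbT.
  by rewrite mem_filter => /andP[aj _] ->; rewrite phi'K /= eqxx.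
apply: perm_trans (perm_map _ ps) _; rewrite -map_comp.
by under eq_map do rewrite /= phi'K.
Qed.

Theorem corollary4p8 :
  (forall (gT hT : finGroupType) (G : {group gT}) (H : {group hT}),
     CA_group G -> ~~ abelian G -> CA_group H -> ~~ abelian H ->
     let bG := #|max_abelian_subgroups G| in
     let bH := #|max_abelian_subgroups H| in
     let mG := (bG - 1)%N in
     let mH := (bH - 1)%N in
     (exists2 a : seq nat,
        diagonal_presentation
          (commuting_difference_lattice (setX_group G H)) a
        & perm_eq (nontrivial a)
            (nseq bH mG ++ nseq bG mH ++ [:: (mG * mH)%N])) /\
     (exists2 s : seq nat,
        unique (smith_spectrum (setX_group G H)) s
        & (\prod_(d <- s) d = mG ^ bH.+1 * mH ^ bG.+1)%N)) /\
  (forall (aT : finGroupType) (A : {group aT}),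
     abelian A ->
     (forall v, commuting_difference_lattice A v <-> v = 0) /\
     (forall (gT : finGroupType) (G : {group gT}),
        exists2 s : seq nat,
          unique (smith_spectrum G) s
          & unique (smith_spectrum (setX_group G A)) s)).
Proof.
split=> [gT hT G H caG nabG caH nabH bG bH mG mH | aT A abA]; split.
- exact: CA_setX_diagonal_presentation.
- have [d invd] :=
    commuting_difference_lattice_invariant_factors (setX_group G H).
  exists (nontrivial d); first exact: smith_spectrum_unique.
  have [a Xa pa] := CA_setX_diagonal_presentation caG nabG caH nabH.
  have [d_gt0 _] := invd.1; have [a_gt0 _] := Xa.
  rewrite nontrivial_prod // (diagonal_presentation_prod invd.1 Xa).
  rewrite -nontrivial_prod // (perm_big _ pa) /= !big_cat big_seq1 /=.
  by rewrite !big_nseq !iter_muln_1 !expnSr mulnA mulnACA.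
- by move=> v; apply: abelian_commuting_difference_lattice.
move=> gT G.
have [d [Gd sd]] := commuting_difference_lattice_invariant_factors G.
exists (nontrivial d); apply: smith_spectrum_unique => //.
by split=> //; apply: diagonal_presentation_setX_abelian.
Qed.
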